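(* Let $I_1,I_2$ be positive integers, let $\mathbb{M}$ be the group (under matrix multiplication $\cdot$) of all invertible real $I_1I_2\times I_1I_2$ matrices, and let $\mathbb{T}=\{\mathcal{T}\in\mathbb{R}^{I_1\times I_2\times I_1\times I_2}:\det(f(\mathcal{T}))\neq 0\}$, where $f$ is the matricization map. For any bijection $g:\mathbb{T}\to\mathbb{M}$, the operation $(\mathcal{A},\mathcal{B})\mapsto g^{-1}[g(\mathcal{A})\cdot g(\mathcal{B})]$ on $\mathbb{T}$ satisfies the group axioms, and $g$ is a group isomorphism from $\mathbb{T}$ with this operation onto $(\mathbb{M},\cdot)$. In particular, for $g=f|_{\mathbb{T}}$ this operation is the Einstein product, $\mathcal{A}\ast_2\mathcal{B}=f^{-1}[f(\mathcal{A})\cdot f(\mathcal{B})]$ for all $\mathcal{A},\mathcal{B}\in\mathbb{T}$, so $(\mathbb{T},\ast_2)$ is a group and $f:\mathbb{T}\to\mathbb{M}$ is a group isomorphism.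
   Context: The matricization map $f:\mathbb{R}^{I_1\times I_2\times I_1\times I_2}\to\mathbb{R}^{I_1I_2\times I_1I_2}$ is defined entrywise by $(f(\mathcal{A}))_{[i_1+(i_2-1)I_1],[j_1+(j_2-1)I_1]}=a_{i_1i_2j_1j_2}$ for $1\le i_1,j_1\le I_1$, $1\le i_2,j_2\le I_2$. The Einstein product $\ast_2$ of $\mathcal{A},\mathcal{B}\in\mathbb{R}^{I_1\times I_2\times I_1\times I_2}$ is $(\mathcal{A}\ast_2\mathcal{B})_{i_1i_2j_1j_2}=\sum_{u=1}^{I_1}\sum_{v=1}^{I_2}a_{i_1i_2uv}\,b_{uvj_1j_2}$. *)

(* Defs.v *)
From HB Require Import structures.
From mathcomp Require Import all_boot all_order all_algebra.
From mathcomp Require Import reals.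

Set Implicit Arguments.
Unset Strict Implicit.
Unset Printing Implicit Defensive.

Import GRing.Theory.
Local Open Scope ring_scope.

Section Groups.

Definition is_group (T : Type) (op : T -> T -> T) : Prop :=
  associative op /\
  exists e : T, exists inv : T -> T,
    [/\ left_id e op, right_id e op, left_inverse e inv op
      & right_inverse e inv op].

Definition is_group_iso (T : Type) (G : groupType) (op : T -> T -> T)
    (g : T -> G) : Prop :=
  bijective g /\ {morph g : x y / op x y >-> (x * y)%g}.

Definition transport_op (T : Type) (G : groupType) (g : T -> G) (ginv : G -> T)
    (x y : T) : T :=
  ginv (g x * g y)%g.

End Groups.

(* matrix.v builds GL_n only over finite rings, and makes 'M[F]_n a unitRingType
   only for n of the form n'.+1, which I1 * I2 is not syntactically. *)
Section GeneralLinear.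
Variables (F : fieldType) (n : nat).

Definition GLmx : Type := {B : 'M[F]_n | B \in unitmx}.

HB.instance Definition _ := Choice.on GLmx.

Implicit Types A B C : GLmx.

Fact GLmx_one_subproof : 1%:M \in @unitmx F n.
Proof. exact: unitmx1. Qed.

Fact GLmx_mul_subproof A B : val A *m val B \in unitmx.
Proof. by rewrite unitmx_mul (valP A) (valP B). Qed.

Fact GLmx_inv_subproof A : invmx (val A) \in unitmx.
Proof. by rewrite unitmx_inv (valP A). Qed.

Definition GLmx_one : GLmx := Sub 1%:M GLmx_one_subproof.
Definition GLmx_mul A B : GLmx := Sub (val A *m val B) (GLmx_mul_subproof A B).
Definition GLmx_inv A : GLmx := Sub (invmx (val A)) (GLmx_inv_subproof A).

Fact GLmx_mulA : associative GLmx_mul.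
Proof. by move=> A B C; apply: val_inj; rewrite /= mulmxA. Qed.

Fact GLmx_mul1g : left_id GLmx_one GLmx_mul.
Proof. by move=> A; apply: val_inj; rewrite /= mul1mx. Qed.

Fact GLmx_mulg1 : right_id GLmx_one GLmx_mul.
Proof. by move=> A; apply: val_inj; rewrite /= mulmx1. Qed.

Fact GLmx_mulVg : left_inverse GLmx_one GLmx_inv GLmx_mul.
Proof. by move=> A; apply: val_inj; rewrite /= mulVmx ?(valP A). Qed.

Fact GLmx_mulgV : right_inverse GLmx_one GLmx_inv GLmx_mul.
Proof. by move=> A; apply: val_inj; rewrite /= mulmxV ?(valP A). Qed.

HB.instance Definition _ :=
  isGroup.Build GLmx GLmx_mulA GLmx_mul1g GLmx_mulg1 GLmx_mulVg GLmx_mulgV.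

End GeneralLinear.

Section Tensors.
Variables (F : fieldType) (I1 I2 : nat).

Definition tensor : Type := {ffun 'I_I1 * 'I_I2 * 'I_I1 * 'I_I2 -> F}.

Implicit Types A B : tensor.

Definition einstein_prod A B : tensor :=
  [ffun t : 'I_I1 * 'I_I2 * 'I_I1 * 'I_I2 => let: (i1, i2, j1, j2) := t in
     \sum_(u < I1) \sum_(v < I2) A (i1, i2, u, v) * B (u, v, j1, j2)].

Fact pair_idx_subproof (i1 : 'I_I1) (i2 : 'I_I2) : (i1 + i2 * I1 < I1 * I2)%N.
Proof.
apply: (@leq_trans (i2.+1 * I1)); first by rewrite mulSn ltn_add2r.
by rewrite mulnC leq_mul2l ltn_ord orbT.
Qed.

(* i1 + (i2 - 1) I1 for 1-based indices becomes i1 + i2 I1 for 0-based ones. *)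
Definition pair_idx (i1 : 'I_I1) (i2 : 'I_I2) : 'I_(I1 * I2) :=
  Ordinal (pair_idx_subproof i1 i2).

Fact ord_mul_gt0l (p : 'I_(I1 * I2)) : (0 < I1)%N.
Proof.
by have := leq_ltn_trans (leq0n p) (ltn_ord p); rewrite muln_gt0 => /andP[].
Qed.

Fact idx_fst_subproof (p : 'I_(I1 * I2)) : (p %% I1 < I1)%N.
Proof. by rewrite ltn_mod (ord_mul_gt0l p). Qed.

Fact idx_snd_subproof (p : 'I_(I1 * I2)) : (p %/ I1 < I2)%N.
Proof. by rewrite ltn_divLR ?(ord_mul_gt0l p) // [leqRHS]mulnC. Qed.

Definition idx_fst (p : 'I_(I1 * I2)) : 'I_I1 := Ordinal (idx_fst_subproof p).
Definition idx_snd (p : 'I_(I1 * I2)) : 'I_I2 := Ordinal (idx_snd_subproof p).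

Lemma pair_idxK1 i1 i2 : idx_fst (pair_idx i1 i2) = i1.
Proof. by apply: val_inj; rewrite /= addnC modnMDl modn_small. Qed.

Lemma pair_idxK2 i1 i2 : idx_snd (pair_idx i1 i2) = i2.
Proof.
have I1_gt0 : (0 < I1)%N by apply: leq_ltn_trans (ltn_ord i1).
by apply: val_inj; rewrite /= addnC divnMDl // divn_small ?addn0.
Qed.

Definition matricize A : 'M[F]_(I1 * I2) :=
  \matrix_(p, q) A (idx_fst p, idx_snd p, idx_fst q, idx_snd q).

Lemma matricizeE A i1 i2 j1 j2 :
  matricize A (pair_idx i1 i2) (pair_idx j1 j2) = A (i1, i2, j1, j2).
Proof. by rewrite mxE !pair_idxK1 !pair_idxK2. Qed.

Definition nonsing_tensor : Type := {A : tensor | \det (matricize A) != 0}.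

Fact matricize_unit (A : nonsing_tensor) : matricize (val A) \in unitmx.
Proof. by rewrite unitmxE unitfE (valP A). Qed.

Definition matricize_GL (A : nonsing_tensor) : GLmx F (I1 * I2) :=
  Sub (matricize (val A)) (matricize_unit A).

End Tensors.

(* Main.v *)
Require Import Defs.
From mathcomp Require Import all_boot all_order all_algebra.
From mathcomp Require Import reals.
Import GRing.Theory.

(** A bijection onto a group carries the group law back, so the first part is
    pure transport of structure. For the second part, matricization is the
    reindexing of tensors along the bijection between pairs of indices and
    [{0, ..., I1 * I2 - 1}]; under it the double sum of the Einstein product
    becomes the single sum of the matrix product. *)

Section Transport.
Variables (T : Type) (G : groupType) (g : T -> G) (ginv : G -> T).
Hypotheses (gK : cancel g ginv) (ginvK : cancel ginv g).

Lemma transport_op_is_group : is_group (transport_op g ginv).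
Proof.
split=> [x y z|]; first by rewrite /transport_op !ginvK mulgA.
(* Both witnesses are forced: [g] has to send the unit to [1] and the inverse of [x] to the inverse
   of [g x]. *)
exists (ginv 1%g), (fun x => ginv (g x)^-1%g); rewrite /transport_op.
by split=> x; rewrite !ginvK ?(mul1g, mulg1, mulVg, mulgV) ?gK.
Qed.

Lemma transport_op_is_group_iso : is_group_iso (transport_op g ginv) g.
Proof. by split=> [|x y]; [exists ginv | rewrite /transport_op ginvK]. Qed.

End Transport.

Section Matricization.
Local Open Scope ring_scope.
Variables (F : fieldType) (I1 I2 : nat).
Implicit Types A B : tensor F I1 I2.

(** Euclidean division of [p] by [I1]: the remainder is the first index, the quotient the second. *)
Lemma pair_idx_surj (p : 'I_(I1 * I2)) : pair_idx (idx_fst p) (idx_snd p) = p.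
Proof. by apply: val_inj; rewrite /= addnC -divn_eq. Qed.

Lemma big_pair_idx (f : 'I_I1 -> 'I_I2 -> F) :
  \sum_(p < I1 * I2) f (idx_fst p) (idx_snd p) = \sum_u \sum_v f u v.
Proof.
rewrite pair_bigA /=.
rewrite (reindex (fun p : 'I_(I1 * I2) => (idx_fst p, idx_snd p))) //=.
exists (fun uv => pair_idx uv.1 uv.2) => [p _ | [u v] _] /=.
- exact: pair_idx_surj.
- by rewrite pair_idxK1 pair_idxK2.
Qed.

Lemma matricize_einstein A B :
  matricize (einstein_prod A B) = matricize A *m matricize B.
Proof.
apply/matrixP=> p q; rewrite !mxE ffunE /= -big_pair_idx.
by apply: eq_bigr => r _; rewrite !mxE.
Qed.

(** The two-sided inverse of [matricize], defined on all matrices; invertibility enters only on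
    restriction to [GLmx]. *)
Definition tensorize (M : 'M[F]_(I1 * I2)) : tensor F I1 I2 :=
  [ffun t : 'I_I1 * 'I_I2 * 'I_I1 * 'I_I2 => let: (i1, i2, j1, j2) := t in
     M (pair_idx i1 i2) (pair_idx j1 j2)].

Lemma matricizeK : cancel (@matricize F I1 I2) tensorize.
Proof. by move=> A; apply/ffunP=> -[[[i1 i2] j1] j2]; rewrite ffunE matricizeE. Qed.

Lemma tensorizeK : cancel tensorize (@matricize F I1 I2).
Proof. by move=> M; apply/matrixP=> p q; rewrite mxE ffunE !pair_idx_surj. Qed.

Fact tensorize_GL_subproof (M : GLmx F (I1 * I2)) :
  \det (matricize (tensorize (val M))) != 0.
Proof. by rewrite tensorizeK -unitfE -unitmxE (valP M). Qed.

Definition tensorize_GL (M : GLmx F (I1 * I2)) : nonsing_tensor F I1 I2 :=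
  Sub (tensorize (val M)) (tensorize_GL_subproof M).

Lemma matricize_GLK : cancel (@matricize_GL F I1 I2) tensorize_GL.
Proof. by move=> A; apply: val_inj; rewrite /= matricizeK. Qed.

Lemma tensorize_GLK : cancel tensorize_GL (@matricize_GL F I1 I2).
Proof. by move=> M; apply: val_inj; rewrite /= tensorizeK. Qed.

(** Since the left side is the value of a nonsingular tensor, this also gives closure of nonsingular
    tensors under the Einstein product. *)
Lemma val_transport_matricize (A B : nonsing_tensor F I1 I2) :
  val (transport_op (@matricize_GL F I1 I2) tensorize_GL A B) =
  einstein_prod (val A) (val B).
Proof. by rewrite /= -matricize_einstein matricizeK. Qed.

End Matricization.

Theorem theorem3p5 (R : realType) (I1 I2 : nat)
    (hI1 : (0 < I1)%N) (hI2 : (0 < I2)%N) :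
  (forall (g : nonsing_tensor R I1 I2 -> GLmx R (I1 * I2))
          (ginv : GLmx R (I1 * I2) -> nonsing_tensor R I1 I2),
      cancel g ginv -> cancel ginv g ->
      is_group (transport_op g ginv) /\
      is_group_iso (transport_op g ginv) g)
  /\
  (exists (finv : GLmx R (I1 * I2) -> nonsing_tensor R I1 I2)
          (ein : nonsing_tensor R I1 I2 -> nonsing_tensor R I1 I2 ->
                 nonsing_tensor R I1 I2),
      [/\ cancel (@matricize_GL R I1 I2) finv,
          cancel finv (@matricize_GL R I1 I2),
          forall A B, val (ein A B) = einstein_prod (val A) (val B),
          forall A B, ein A B = transport_op (@matricize_GL R I1 I2) finv A B
        & is_group ein /\ is_group_iso ein (@matricize_GL R I1 I2)]).
Proof.
split=> [g ginv gK ginvK|].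
  by split; [apply: transport_op_is_group | apply: transport_op_is_group_iso].
have fK := @matricize_GLK R I1 I2; have finvK := @tensorize_GLK R I1 I2.
exists (@tensorize_GL R I1 I2).
(* Taking the transported law itself as [ein] makes its equality with [transport_op] hold by
   definition; what remains is that its values are Einstein products. *)
exists (transport_op (@matricize_GL R I1 I2) (@tensorize_GL R I1 I2)).
split=> //; first exact: val_transport_matricize.
by split; [apply: transport_op_is_group | apply: transport_op_is_group_iso].
Qed.
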